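(* Algorithm $\mathrm{AG}^0$ (defined in the context), when fed with the output of algorithm $\mathrm{AG}^1$ (defined in the context), computes the switching index: it produces an ordering $i_0^1,\dots,i_0^n$ of all states of $N$ and values $\nu^*_{(0,i_0^{1})},\dots,\nu^*_{(0,i_0^{n})}$ such that, for every $i\in N$, the value $\nu^*_{(0,i)}$ output by the algorithm equals the switching index of state $i$, namely $$\max_{S\subseteq N\colon i\in S}\frac{f_i^S-c_i}{g_i^S}.$$
   Context: Project: finite state space $N$ with $n=|N|$, stochastic matrix $(p_{ij})_{i,j\in N}$, active rewards $R_i\in\mathbb{R}$, startup costs $c_i\ge0$ ($i\in N$), zero shutdown costs, discount factor $0<\beta<1$. For $S\subseteq N$, consider the project without switching costs under the policy that engages it exactly when its state lies in $S$ (engaging in state $i$ yields $R_i$ and moves to $j$ with probability $p_{ij}$; resting yields $0$ and freezes the state). Its expected total discounted work $g_i^S$ and reward $f_i^S$ starting at $i$ are the unique solutions of: $g_i^S=1+\beta\sum_{j\in S}p_{ij}g_j^S$ and $f_i^S=R_i+\beta\sum_{j\in S}p_{ij}f_j^S$ for $i\in S$; $g_i^S=f_i^S=0$ for $i\notin S$. For $i\in N$ let $w_i^S=1+\beta\sum_{j\in N}p_{ij}g_j^S-\beta g_i^S$ (which is $>0$), $r_i^S=R_i+\beta\sum_{j\in N}p_{ij}f_j^S-\beta f_i^S$, and $\nu_i^S=r_i^S/w_i^S$. The switching index of state $i$ is the marginal productivity index of the augmented state $(0,i)$ (previously passive, state $i$) in the restless reformulation of the project, which equals $\max_{S\ni i}(f_i^S-c_i)/g_i^S$.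 Algorithm $\mathrm{AG}^1$: set $S_1^0=\emptyset$. For $k_1=1,\dots,n$: pick (ties broken arbitrarily) $i_1^{k_1}\in\arg\max\{\nu_i^{S_1^{k_1-1}}:i\in N\setminus S_1^{k_1-1}\}$; set $\nu^*_{i_1^{k_1}}=\nu_{i_1^{k_1}}^{S_1^{k_1-1}}$ and $S_1^{k_1}=S_1^{k_1-1}\cup\{i_1^{k_1}\}$. Write $w_j^{(k_1)}=w_j^{S_1^{k_1}}$ and $\nu_j^{(k_1)}=\nu_j^{S_1^{k_1}}$. Output: $\{i_1^{k_1},\ \nu^*_{i_1^{k_1}},\ (w_j^{(k_1)},\nu_j^{(k_1)})_{j\in S_1^{k_1}}\}_{k_1=1}^n$. Algorithm $\mathrm{AG}^0$ (input: the output of $\mathrm{AG}^1$). Set $\hat c_j=(1-\beta)c_j$ for $j\in N$, $S_0^0=\emptyset$, $S_1^0=\emptyset$, $k_0=0$. For $k_1=1,\dots,n$: - set $S_1^{k_1}=S_1^{k_1-1}\cup\{i_1^{k_1}\}$ and compute $\nu^{(0,k_1)}_{(0,j)}=\nu_j^{(k_1)}-\hat c_j/w_j^{(k_1)}$ for $j\in S_1^{k_1}\setminus S_0^{k_0}$; - while $k_0<k_1$: pick (ties broken arbitrarily) $j_0^{\max}\in\arg\max\{\nu^{(0,k_1)}_{(0,j)}:j\in S_1^{k_1}\setminus S_0^{k_0}\}$; if $k_1=n$ or $\nu^*_{i_1^{k_1+1}}<\nu^{(0,k_1)}_{(0,j_0^{\max})}$, then set $i_0^{k_0+1}=j_0^{\max}$,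 $\nu^*_{(0,i_0^{k_0+1})}=\nu^{(0,k_1)}_{(0,i_0^{k_0+1})}$, $S_0^{k_0+1}=S_0^{k_0}\cup\{i_0^{k_0+1}\}$, and increase $k_0$ by $1$; otherwise exit the while loop (and proceed to the next $k_1$). Output: $\{i_0^{k_0},\nu^*_{(0,i_0^{k_0})}\}_{k_0=1}^n$. *)

(* Defs.v *)
From mathcomp Require Import all_boot all_order all_algebra.
(* Not imported: it would shadow finset's set0. *)
From mathcomp Require classical_sets.
From mathcomp Require Import reals.

Set Implicit Arguments.
Unset Strict Implicit.
Unset Printing Implicit Defensive.

Import Order.TTheory GRing.Theory Num.Theory.
Local Open Scope ring_scope.

Record project (R : realType) (N : finType) := Project {
  trans : N -> N -> R;
  reward : N -> R;
  startup : N -> R;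
  discount : R;
  trans_ge0 : forall i j, 0 <= trans i j;
  trans_sum1 : forall i, \sum_j trans i j = 1;
  startup_ge0 : forall i, 0 <= startup i;
  discount_gt0 : 0 < discount;
  discount_lt1 : discount < 1 }.

(* The evaluation equations of the policy "engage exactly on S" when engaging
   in state i yields a i: a = 1 gives the work g^S, a = reward the reward f^S. *)
Definition policy_equations (R : realType) (N : finType) (P : project R N)
    (a : N -> R) (S : {set N}) (v : N -> R) : Prop :=
  (forall i, i \in S ->
     v i = a i + discount P * \sum_(j in S) trans P i j * v j) /\
  (forall i, i \notin S -> v i = 0).

(* The unique solution of these equations (policy_value_unique below); the
   default value 0 of xget is never used. *)
Definition policy_value (R : realType) (N : finType) (P : project R N)
    (a : N -> R) (S : {set N}) : {ffun N -> R} :=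
  classical_sets.xget 0 (fun v : {ffun N -> R} => policy_equations P a S v).

Lemma policy_equations_inj (R : realType) (N : finType) (P : project R N)
    (S : {set N}) (v : N -> R) :
  policy_equations P (fun=> 0) S v -> forall i, v i = 0.
Proof.
move=> [vS vNS] i0.
have [i _ imax] := @arg_maxP _ _ _ i0 xpredT (fun i => `|v i|) isT.
suff vi0 : `|v i| <= 0.
  by apply/eqP; rewrite -normr_le0; apply: le_trans (imax i0 isT) vi0.
have [iS|/vNS ->] := boolP (i \in S); last by rewrite normr0.
have b0 := discount_gt0 P; have b1 := discount_lt1 P.
have le_vi : `|v i| <= discount P * `|v i|.
  rewrite {1}(vS i iS) add0r normrM (gtr0_norm b0) ler_wpM2l ?(ltW b0) //.
  apply: le_trans (ler_norm_sum _ _ _) _.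
  rewrite -[leRHS]mul1r -(trans_sum1 P i) mulr_suml big_mkcond /=.
  apply: ler_sum => j _; case: ifP => _.
    rewrite normrM (ger0_norm (trans_ge0 P i j)).
    exact: ler_wpM2l (trans_ge0 P i j) _ _ (imax j isT).
  exact: mulr_ge0 (trans_ge0 P i j) (normr_ge0 _).
by rewrite -(@pmulr_rle0 _ (1 - discount P)) ?subr_gt0 // mulrBl mul1r subr_le0.
Qed.

Lemma policy_value_exists (R : realType) (N : finType) (P : project R N)
    (a : N -> R) (S : {set N}) :
  exists v : {ffun N -> R}, policy_equations P a S v.
Proof.
pose q i j : R :=
  if (i \in S) && (j \in S) then discount P * trans P i j else 0.
pose A : 'M[R]_#|N| :=
  \matrix_(k, l) ((k == l)%:R - q (enum_val k) (enum_val l)).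
pose V (v : 'cV[R]_#|N|) : {ffun N -> R} := [ffun i => v (enum_rank i) 0].
have AE (v : 'cV[R]_#|N|) i :
    (A *m v) (enum_rank i) 0 = V v i - \sum_j q i j * V v j.
  rewrite mxE (reindex _ (onW_bij _ (enum_rank_bij N))) /=.
  under eq_bigr do rewrite mxE !enum_rankK mulrBl (inj_eq enum_rank_inj).
  rewrite sumrB (bigD1 i) //= eqxx mul1r big1 ?addr0.
    by rewrite ffunE; congr (_ - _); apply: eq_bigr => j _; rewrite ffunE.
  by move=> j ji; rewrite eq_sym (negbTE ji) mul0r.
have sol (b : N -> R) (v : 'cV[R]_#|N|) :
    (forall i, (A *m v) (enum_rank i) 0 = if i \in S then b i else 0) ->
    policy_equations P b S (V v).
  move=> Hv; split=> i iS; move: (Hv i); rewrite AE /q.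
    rewrite iS => /eqP; rewrite subr_eq => /eqP ->; congr (_ + _).
    rewrite mulr_sumr [RHS]big_mkcond; apply: eq_bigr => j _ /=.
    by case: ifP => _; rewrite ?mul0r ?mulrA.
  by rewrite (negbTE iS) big1 ?subr0 // => j _; rewrite mul0r.
have uA : A \in unitmx.
  rewrite -unitmx_tr unitmxE unitfE; apply/det0P => -[v /eqP v0 Hv]; apply: v0.
  have /policy_equations_inj V0 : policy_equations P (fun=> 0) S (V v^T).
    apply: sol => i; rewrite if_same.
    by rewrite -[A]trmxK -trmx_mul Hv trmx0 mxE.
  apply/rowP => k; rewrite mxE; move: (V0 (enum_val k)).
  by rewrite ffunE enum_valK mxE.
exists (V (invmx A *m \col_k (if enum_val k \in S then a (enum_val k) else 0))).
by apply: sol => i; rewrite mulmxA mulmxV // mul1mx mxE enum_rankK.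
Qed.

Lemma policy_valueP (R : realType) (N : finType) (P : project R N)
    (a : N -> R) (S : {set N}) :
  policy_equations P a S (policy_value P a S).
Proof.
exact: (classical_sets.xgetPex (0 : {ffun N -> R}) (policy_value_exists P a S)).
Qed.

Lemma policy_value_unique (R : realType) (N : finType) (P : project R N)
    (a : N -> R) (S : {set N}) (v : N -> R) :
  policy_equations P a S v -> v =1 policy_value P a S.
Proof.
move=> [vS vNS] i; have [uS uNS] := policy_valueP P a S.
apply/eqP; rewrite -subr_eq0; apply/eqP; move: i.
apply: (@policy_equations_inj _ _ P S (fun i => v i - policy_value P a S i)).
split=> i iS; last by rewrite vNS // uNS // subrr.
rewrite vS // uS // opprD addrACA subrr -mulrBr -sumrB; congr (_ + _ * _).
by apply: eq_bigr => j _; rewrite mulrBr.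
Qed.

Definition work (R : realType) (N : finType) (P : project R N) (S : {set N}) :=
  policy_value P (fun=> 1) S.

Definition rwd (R : realType) (N : finType) (P : project R N) (S : {set N}) :=
  policy_value P (reward P) S.

Definition marginal_work (R : realType) (N : finType) (P : project R N)
    (S : {set N}) (i : N) : R :=
  1 + discount P * \sum_j trans P i j * work P S j - discount P * work P S i.

Definition marginal_reward (R : realType) (N : finType) (P : project R N)
    (S : {set N}) (i : N) : R :=
  reward P i + discount P * \sum_j trans P i j * rwd P S j
    - discount P * rwd P S i.

Definition marginal_rate (R : realType) (N : finType) (P : project R N)
    (S : {set N}) (i : N) : R :=
  marginal_reward P S i / marginal_work P S i.

Definition switching_ratio (R : realType) (N : finType) (P : project R N)
    (i : N) (S : {set N}) : R :=
  (rwd P S i - startup P i) / work P S i.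

(* The maximum over the sets S containing i; the seed of the iterated maximum
   is the ratio of [set i], itself one of these sets. *)
Definition switching_index (R : realType) (N : finType) (P : project R N)
    (i : N) : R :=
  \big[Num.max/switching_ratio P i [set i]]_(S : {set N} | i \in S)
    switching_ratio P i S.

Definition argmax (R : realType) (N : finType) (A : {set N}) (F : N -> R) :
    {set N} :=
  [set i in A | [forall j in A, F j <= F i]].

(* A tie-breaking rule. The algorithms take one such rule for each pick (indexed
   by the values of the counters at the time of the pick, which never repeat
   within a run), so that quantifying over all families of rules covers every
   possible sequence of choices. *)
Definition tie_rule (N : finType) (tie : {set N} -> N) : Prop :=
  forall A : {set N}, A != set0 -> tie A \in A.

(* What AG1 outputs at its iteration k1: the state i_1^{k1}, its index, and the
   pairs (w_j, nu_j) for j in S_1^{k1} (set to 0 for the other j). *)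
Record AG1_row (R : realType) (N : finType) := AG1Row {
  row_state : N;
  row_index : R;
  row_work : N -> R;
  row_rate : N -> R }.

(* The m iterations k1, k1 + 1, ... started from S = S_1^{k1 - 1}. *)
Fixpoint AG1_loop (R : realType) (N : finType) (P : project R N)
    (tie : nat -> {set N} -> N) (m k1 : nat) (S : {set N}) :
    seq (AG1_row R N) :=
  if m is m'.+1 then
    let i := tie k1 (argmax (~: S) (marginal_rate P S)) in
    let S' := i |: S in
    {| row_state := i;
       row_index := marginal_rate P S i;
       row_work := fun j => if j \in S' then marginal_work P S' j else 0;
       row_rate := fun j => if j \in S' then marginal_rate P S' j else 0 |}
    :: AG1_loop P tie m' k1.+1 S'
  else [::].

Definition AG1 (R : realType) (N : finType) (P : project R N)
    (tie : nat -> {set N} -> N) : seq (AG1_row R N) :=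
  AG1_loop P tie #|N| 1 set0.

Definition AG0_rate (R : realType) (N : finType) (beta : R) (c : N -> R)
    (r : AG1_row R N) (j : N) : R :=
  row_rate r j - (1 - beta) * c j / row_work r j.

(* The while loop of AG0. The list out of the pairs (state, index) output so far
   carries k_0 (its size) and S_0^{k_0} (the states in it). Each iteration that
   does not exit increases k_0 by one, so that "while k_0 < k_1" means at most
   m = k_1 - k_0 iterations. The argument next is the index of i_1^{k_1 + 1},
   or None if k_1 = n. *)
Fixpoint AG0_while (R : realType) (N : finType) (tie : nat -> {set N} -> N)
    (rate : N -> R) (S1 : {set N}) (next : option R) (m : nat)
    (out : seq (N * R)) : seq (N * R) :=
  if m is m'.+1 then
    let S0 := [set i in unzip1 out] in
    let j := tie (size out) (argmax (S1 :\: S0) rate) in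
    if (if next is Some x then x < rate j else true) then
      AG0_while tie rate S1 next m' (rcons out (j, rate j))
    else out
  else out.

(* The iterations k1, k1 + 1, ..., n, with S1 = S_1^{k1 - 1} and rows the
   remaining part of the output of AG1. *)
Fixpoint AG0_loop (R : realType) (N : finType) (beta : R) (c : N -> R)
    (tie : nat -> nat -> {set N} -> N) (k1 : nat) (S1 : {set N})
    (rows : seq (AG1_row R N)) (out : seq (N * R)) : seq (N * R) :=
  if rows is r :: rows' then
    let S1' := row_state r |: S1 in
    let next := ohead (map (@row_index R N) rows') in
    AG0_loop beta c tie k1.+1 S1' rows'
      (AG0_while (tie k1) (AG0_rate beta c r) S1' next (k1 - size out) out)
  else out.

Definition AG0 (R : realType) (N : finType) (beta : R) (c : N -> R)
    (tie : nat -> nat -> {set N} -> N) (rows : seq (AG1_row R N)) :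
    seq (N * R) :=
  AG0_loop beta c tie 1 set0 rows [::].

(* Main.v *)
(** Subtracting a charge [lam] per unit of work turns the project into an
    optimal stopping problem with values [rwd - lam * work].  If [nu_k] denotes
    the index picked by AG1 at step [k], the set [S_k] is optimal for every
    charge in the interval from [nu_(k+1)] to [nu_k], because adding a state whose
    marginal rate is [lam] does not change the value at charge [lam].  On [S_k],
    the rates compared by AG0 are the ratios [(f_j - c_j) / g_j].  When AG0 picks
    [j] at stage [k] with ratio [v], the test of the while loop gives
    [nu_(k+1) < v], and the failure to pick [j] earlier (or [c_j >= 0], if [j] has
    just entered) gives [v <= nu_k]; hence [S_k] is optimal at charge [v], where
    its value at [j] is exactly [c_j], so that no set has a larger ratio at [j]. *)
Require Import Defs.
From mathcomp Require Import all_boot all_order all_algebra.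
From mathcomp Require Import reals.

Set Implicit Arguments.
Unset Strict Implicit.
Unset Printing Implicit Defensive.

Import Order.TTheory GRing.Theory Num.Theory.
Local Open Scope ring_scope.

(** * Argmax sets *)

Lemma argmax_neq0 (R : realType) (N : finType) (A : {set N}) (F : N -> R) :
  A != set0 -> argmax A F != set0.
Proof.
case/set0Pn=> i0 i0A; apply/set0Pn.
have [i iA imax] := @arg_maxP _ _ _ i0 (mem A) F i0A.
exists i; rewrite inE; apply/andP; split=> //.
by apply/forall_inP => j jA; exact: imax.
Qed.

Lemma argmaxP (R : realType) (N : finType) (A : {set N}) (F : N -> R) (i : N) :
  reflect (i \in A /\ forall j, j \in A -> F j <= F i) (i \in argmax A F).
Proof.
rewrite inE; apply: (iffP andP) => -[iA].
  by move/forall_inP=> imax; split.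
by move=> imax; split=> //; apply/forall_inP.
Qed.

(** * Policy values and positivity of work *)

Section Net.
Variables (R : realType) (N : finType) (P : project R N).
Implicit Types (S T : {set N}) (lam mu : R) (i j : N).

(** At a maximiser [i] of [d] the average of [d] is at most [d i], so the second case gives
    [d i <= discount P * d i], which forces [d i <= 0]. *)
Lemma max_principle (d : N -> R) :
  (forall i, d i <= 0 \/ d i <= discount P * \sum_j trans P i j * d j) ->
  forall i, d i <= 0.
Proof.
move=> dP i0.
have [i _ imax] := @arg_maxP _ _ _ i0 xpredT d isT.
suff di0 : d i <= 0 by apply: le_trans (imax i0 isT) di0.
have [//|le_di] := dP i.
have: d i <= discount P * d i.
  apply: le_trans le_di _; rewrite ler_wpM2l ?(ltW (discount_gt0 P)) //.
  rewrite -[leRHS]mul1r -(trans_sum1 P i) mulr_suml.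
  by apply: ler_sum => j _; apply: ler_wpM2l (trans_ge0 P i j) _ _ (imax j isT).
by rewrite -subr_le0 -{1}[d i]mul1r -mulrBl pmulr_rle0 // subr_gt0 discount_lt1.
Qed.

Lemma policy_value_in (a : N -> R) S i : i \in S ->
  policy_value P a S i =
  a i + discount P * \sum_j trans P i j * policy_value P a S j.
Proof.
have [vS vNS] := policy_valueP P a S.
move=> iS; rewrite {1}vS //; congr (_ + _ * _).
rewrite big_mkcond /=; apply: eq_bigr => j _.
by case: ifPn => // /vNS ->; rewrite mulr0.
Qed.

Lemma policy_value_out (a : N -> R) S i :
  i \notin S -> policy_value P a S i = 0.
Proof. by have [_] := policy_valueP P a S; apply. Qed.

Lemma policy_value_eq (a : N -> R) S (v : N -> R) :
  (forall i, i \in S -> v i = a i + discount P * \sum_j trans P i j * v j) ->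
  (forall i, i \notin S -> v i = 0) ->
  v =1 policy_value P a S.
Proof.
move=> vS vNS; apply: policy_value_unique; split=> // i iS.
rewrite vS //; congr (_ + _ * _); rewrite [RHS]big_mkcond /=.
by apply: eq_bigr => j _; case: ifPn => // /vNS ->; rewrite mulr0.
Qed.

Lemma work_ge0 S i : 0 <= work P S i.
Proof.
rewrite -oppr_le0; move: i.
apply: (@max_principle (fun i => - work P S i)) => i.
have [iS|iNS] := boolP (i \in S); last first.
  by left; rewrite /work policy_value_out // oppr0.
right; rewrite {1}/work policy_value_in // opprD.
under [in leRHS]eq_bigr do rewrite mulrN.
by rewrite sumrN mulrN gerDr lerN10.
Qed.

Lemma sum_work_ge0 S i : 0 <= discount P * \sum_j trans P i j * work P S j.
Proof.
apply: mulr_ge0; first exact: ltW (discount_gt0 P).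
by apply: sumr_ge0 => j _; rewrite mulr_ge0 ?trans_ge0 ?work_ge0.
Qed.

Lemma work_gt0 S i : i \in S -> 0 < work P S i.
Proof.
by move=> iS; rewrite /work policy_value_in // ltr_pwDl ?ltr01 ?sum_work_ge0.
Qed.

(** On [S] the policy equation collapses the one-step expression to the value itself; the factor
    [1 - discount P] later cancels in the rates of AG0. *)
Lemma marginal_work_in S i : i \in S ->
  marginal_work P S i = (1 - discount P) * work P S i.
Proof.
move=> iS; rewrite /marginal_work mulrBl mul1r; congr (_ - _).
exact/esym/policy_value_in.
Qed.

Lemma marginal_reward_in S i : i \in S ->
  marginal_reward P S i = (1 - discount P) * rwd P S i.
Proof.
move=> iS; rewrite /marginal_reward mulrBl mul1r; congr (_ - _).
exact/esym/policy_value_in.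
Qed.

Lemma marginal_work_gt0 S i : 0 < marginal_work P S i.
Proof.
have [iS|iNS] := boolP (i \in S).
  by rewrite marginal_work_in // mulr_gt0 ?work_gt0 // subr_gt0 discount_lt1.
rewrite /marginal_work.
have -> : work P S i = 0 by exact: policy_value_out.
rewrite mulr0 subr0.
by rewrite ltr_pwDl ?ltr01 ?sum_work_ge0.
Qed.

(** * Net values at a charge on work *)

Definition net lam S i : R := rwd P S i - lam * work P S i.

Lemma sum_net lam S i :
  \sum_j trans P i j * net lam S j =
  \sum_j trans P i j * rwd P S j - lam * \sum_j trans P i j * work P S j.
Proof.
rewrite mulr_sumr -sumrB; apply: eq_bigr => j _.
by rewrite mulrBr; congr (_ - _); rewrite mulrCA.
Qed.

Lemma net_in lam S i : i \in S ->
  net lam S i =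
  reward P i - lam + discount P * \sum_j trans P i j * net lam S j.
Proof.
move=> iS; rewrite sum_net {1}/net /rwd /work !policy_value_in //.
by rewrite /= [lam * (1 + _)]mulrDr mulr1 mulrBr opprD addrACA [lam * (_ * _)]mulrCA.
Qed.

Lemma net_out lam S i : i \notin S -> net lam S i = 0.
Proof.
by move=> iNS; rewrite /net /rwd /work !policy_value_out // mulr0 subr0.
Qed.

Lemma netE lam S : net lam S =1 policy_value P (fun i => reward P i - lam) S.
Proof.
by apply: policy_value_eq => i; [exact: net_in | exact: net_out].
Qed.

(** This is the gain from engaging once at [i] and then following [S]; its sign is that of the rate
    minus the charge. *)
Lemma net_out_sub lam S i : i \notin S ->
  reward P i - lam + discount P * \sum_j trans P i j * net lam S j =
  (marginal_rate P S i - lam) * marginal_work P S i.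
Proof.
move=> iNS; rewrite mulrBl /marginal_rate divfK ?gt_eqF ?marginal_work_gt0 //.
rewrite /marginal_reward /marginal_work.
have -> : rwd P S i = 0 by exact: policy_value_out.
have -> : work P S i = 0 by exact: policy_value_out.
rewrite !mulr0 !subr0 sum_net [lam * (1 + _)]mulrDr mulr1 mulrBr opprD addrACA.
by rewrite [lam * (_ * _)]mulrCA.
Qed.

Lemma net_anti S i lam mu : lam <= mu -> net mu S i <= net lam S i.
Proof. by move=> le; rewrite /net lerD2l lerN2 ler_wpM2r ?work_ge0. Qed.

(** At this charge engaging once at [i] gains exactly 0, so the net values of [S] also solve the
    policy equations of [i |: S]. *)
Lemma net_add S i : i \notin S ->
  net (marginal_rate P S i) (i |: S) =1 net (marginal_rate P S i) S.
Proof.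
move=> iNS j; rewrite netE; symmetry; move: j; apply: policy_value_eq => j.
  have [-> _|ji] := eqVneq j i; first by rewrite net_out_sub // subrr mul0r net_out.
  by rewrite !inE (negbTE ji) /= => jS; exact: net_in.
by rewrite !inE negb_or => /andP[_ jNS]; exact: net_out.
Qed.

(** * Calibrated sets and their optimality *)

(* The optimality conditions of [S] for the charge [lam]. *)
Definition calibrated lam S : Prop :=
  (forall i, 0 <= net lam S i) /\
  (forall i, i \notin S -> marginal_rate P S i <= lam).

Lemma calibrated_optimal lam S T i :
  calibrated lam S -> net lam T i <= net lam S i.
Proof.
move=> [ge0S leS]; rewrite -subr_le0; move: i.
apply: (@max_principle (fun i => net lam T i - net lam S i)) => i.
have [iT|iNT] := boolP (i \in T); last first.
  by left; rewrite net_out // sub0r oppr_le0.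
right; under eq_bigr do rewrite mulrBr.
rewrite sumrB mulrBr {1}(net_in lam iT) lerBlDr addrC -addrA lerD2l.
rewrite [leRHS]addrC lerBrDr.
(* What remains is the Bellman inequality: engaging once at [i] and then following [S] does not beat
   [S]. *)
have [iS|iNS] := boolP (i \in S); first by rewrite -net_in.
rewrite net_out_sub // [leRHS]net_out // pmulr_lle0 ?marginal_work_gt0 //.
by rewrite subr_le0 leS.
Qed.

Lemma calibrated_le lam mu S : calibrated mu S -> lam <= mu ->
  (forall i, i \notin S -> marginal_rate P S i <= lam) -> calibrated lam S.
Proof.
by move=> [ge0S _] le leS; split=> // i; exact: le_trans (ge0S i) (net_anti _ _ le).
Qed.

(** By [net_add] the net values are unchanged, hence so are the one-step gains, whose signs decide
    the second condition. *)
Lemma calibrated_add S i : i \notin S ->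
  calibrated (marginal_rate P S i) S ->
  calibrated (marginal_rate P S i) (i |: S).
Proof.
move=> iNS [ge0S leS]; split=> [j|j jN]; first by rewrite net_add.
have [ji jNS] : j != i /\ j \notin S by apply/norP; rewrite !inE in jN.
rewrite -subr_le0 -(pmulr_lle0 _ (marginal_work_gt0 (i |: S) j)) -net_out_sub //.
under eq_bigr do rewrite net_add //.
by rewrite net_out_sub // pmulr_lle0 ?marginal_work_gt0 // subr_le0 leS.
Qed.

(** * Switching ratios and the switching index *)

Lemma switching_ratio_le i S lam : i \in S ->
  (switching_ratio P i S <= lam) = (net lam S i <= startup P i).
Proof.
move=> iS; rewrite /switching_ratio ler_pdivrMr ?work_gt0 //.
by rewrite /net lerBlDr lerBlDl.
Qed.

Lemma switching_index_calibrated i S : i \in S ->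
  calibrated (switching_ratio P i S) S ->
  switching_ratio P i S = switching_index P i.
Proof.
move=> iS cal; set v := switching_ratio P i S.
have le_v T : i \in T -> switching_ratio P i T <= v.
  move=> iT; rewrite switching_ratio_le //.
  by apply: le_trans (calibrated_optimal T i cal) _; rewrite -switching_ratio_le.
apply/le_anti/andP; split; first exact: le_bigmax_cond.
by apply: bigmax_le => [|T]; [apply: le_v; rewrite set11 | exact: le_v].
Qed.

(* The bound [v <= nu_k] for a state that AG0 has not picked before stage [k]. *)
Lemma switching_ratio_add i j S : i \notin S -> j \in i |: S ->
  (j \in S -> switching_ratio P j S <= marginal_rate P S i) ->
  switching_ratio P j (i |: S) <= marginal_rate P S i.
Proof.
move=> iNS jiS le_jS; rewrite switching_ratio_le // net_add //.
have [jS|jNS] := boolP (j \in S); first by rewrite -switching_ratio_le // le_jS.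
by rewrite net_out // startup_ge0.
Qed.

Lemma AG0_rateE S (r : AG1_row R N) j : j \in S ->
  row_work r j = marginal_work P S j -> row_rate r j = marginal_rate P S j ->
  AG0_rate (discount P) (startup P) r j = switching_ratio P j S.
Proof.
move=> jS wE rE; rewrite /AG0_rate wE rE /marginal_rate.
rewrite marginal_reward_in // marginal_work_in //.
have nz : 1 - discount P != 0 by rewrite subr_eq0 gt_eqF ?discount_lt1.
by rewrite -mulrBl -mulrBr -mulf_div divff // mul1r.
Qed.

End Net.

(** * The while loop of AG0 *)

(** Here [m] counts the states of [S1] still unpicked, so exhausting it leaves none. The last clause
    is what the next iteration of AG0 needs about unpicked states. *)
Lemma AG0_whileP (R : realType) (N : finType) (tie : nat -> {set N} -> N)
    (rate : N -> R) (S1 : {set N}) (next : option R) (m : nat)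
    (out : seq (N * R)) :
  (forall k0, tie_rule (tie k0)) ->
  uniq (unzip1 out) -> {subset unzip1 out <= S1} ->
  (m + size out = #|S1|)%N ->
  let out' := AG0_while tie rate S1 next m out in
  [/\ uniq (unzip1 out'),
      {subset unzip1 out' <= S1},
      forall j v, (j, v) \in out' -> (j, v) \in out \/
        [/\ j \in S1, j \notin unzip1 out, v = rate j &
            forall x, next = Some x -> x < v] &
      forall j, j \in S1 -> j \notin unzip1 out' ->
        exists2 x, next = Some x & rate j <= x].
Proof.
move=> tieP; elim: m out => [|m IH] out uout sout szout /=.
  split=> // [j v|j jS1 jN]; first by left.
  have /subset_cardP/(_ (introT subsetP sout)) : #|unzip1 out| = #|S1|.
    by move/card_uniqP: uout => ->; rewrite size_map.
  by move/(_ j); rewrite jS1 (negbTE jN).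
set A := S1 :\: _; set j0 := tie _ _.
have A0 : A != set0.
  rewrite -card_gt0 cardsD (setIidPr _); last first.
    by apply/subsetP => i; rewrite inE; exact: sout.
  rewrite cardsE; move/card_uniqP: uout => ->.
  by rewrite size_map -szout addSn subSn ?leq_addl.
have /argmaxP[j0A j0max] : j0 \in argmax A rate.
  by apply: tieP; exact: argmax_neq0.
have [j0N j0S1] : j0 \notin unzip1 out /\ j0 \in S1.
  by move: j0A; rewrite !inE => /andP[].
case: ifP => test; last first.
  split=> // [j v|j jS1 jN]; first by left.
  (* The failed test bounds the rate of [j0], which is maximal among the unpicked states. *)
  move: test; case: (next) => // x /negbT; rewrite -leNgt => le_x.
  by exists x => //; apply: le_trans le_x; apply: j0max; rewrite !inE jN.
have mem_out' j : (j \in unzip1 (rcons out (j0, rate j0))) =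
                  (j == j0) || (j \in unzip1 out).
  by rewrite /unzip1 map_rcons mem_rcons inE.
have [|||u s new old] := IH (rcons out (j0, rate j0)).
- by rewrite /unzip1 map_rcons rcons_uniq j0N.
- by move=> j; rewrite mem_out' => /predU1P[->|/sout].
- by rewrite size_rcons addnS -addSn.
split=> // j v /new[|[jS1 jN vE lt_v]].
  rewrite mem_rcons inE => /predU1P[[-> ->]|]; [right | by left].
  by split=> // x nextE; rewrite nextE in test.
by right; split=> //; apply: contra jN; rewrite mem_out' => ->; rewrite orbT.
Qed.

(** * Joint run of AG1 and AG0 *)

Section Loop.
Variables (R : realType) (N : finType) (P : project R N).
Variables (tie1 : nat -> {set N} -> N) (tie0 : nat -> nat -> {set N} -> N).
Hypothesis tie1P : forall k1 : nat, tie_rule (tie1 k1).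
Hypothesis tie0P : forall k1 k0 : nat, tie_rule (tie0 k1 k0).

Lemma AG1_loop_next m k S x :
  m = #|~: S| ->
  ohead (map (@row_index R N) (AG1_loop P tie1 m k S)) = Some x ->
  forall j, j \notin S -> marginal_rate P S j <= x.
Proof.
case: m => [|m] //= mE [<-] j jNS; set i := tie1 _ _.
have /argmaxP[_ imax] : i \in argmax (~: S) (marginal_rate P S).
  by apply: tie1P; apply: argmax_neq0; rewrite -card_gt0 -mE.
by apply: imax; rewrite inE.
Qed.

Lemma AG1_loop_next_None m k S :
  m = #|~: S| ->
  ohead (map (@row_index R N) (AG1_loop P tie1 m k S)) = None -> S = setT.
Proof.
case: m => [|m] //= /esym/eqP; rewrite cards_eq0 => /eqP SC0 _.
by rewrite -[S]setCK SC0 setC0.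
Qed.

(** Invariants before iteration [k]: [S] is calibrated at the coming index, and unpicked states of
    [S] have ratios at most that index. Quantifying over the argmax makes calibration vacuous once
    [S] is full. *)
Lemma AG0_loopP m k S out :
  m = #|~: S| -> k = #|S|.+1 ->
  (forall i, i \in argmax (~: S) (marginal_rate P S) ->
     calibrated P (marginal_rate P S i) S) ->
  uniq (unzip1 out) -> {subset unzip1 out <= S} ->
  (forall i v, (i, v) \in out -> v = switching_index P i) ->
  (forall j, j \in S -> j \notin unzip1 out -> exists2 x,
     ohead (map (@row_index R N) (AG1_loop P tie1 m k S)) = Some x &
     switching_ratio P j S <= x) ->
  let out' := AG0_loop (discount P) (startup P) tie0 k S
                (AG1_loop P tie1 m k S) out in
  perm_eq (unzip1 out') (enum N) /\
  (forall i v, (i, v) \in out' -> v = switching_index P i).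
Proof.
elim: m k S out => [|m IH] k S out mE kE calS uout sout okout restout.
  split=> //=; apply: uniq_perm => //; first exact: enum_uniq.
  move=> j; rewrite mem_enum; apply: contraT => jN.
  have ST : S = setT by apply: (@AG1_loop_next_None 0 k).
  (* No index follows the last row, so [restout] excludes an unpicked state. *)
  by have [|//|x] := restout j; rewrite ?ST ?inE //; move: jN; case: (j \in _).
rewrite /=; set i := tie1 _ _; set S' := i |: S; set r := AG1Row _ _ _ _.
have imax : i \in argmax (~: S) (marginal_rate P S).
  by apply: tie1P; apply: argmax_neq0; rewrite -card_gt0 -mE.
have iNS : i \notin S by case/argmaxP: imax; rewrite inE.
have calS' : calibrated P (marginal_rate P S i) S'.
  by apply: calibrated_add => //; exact: calS.
have kS' : k = #|S'| by rewrite cardsU1 iNS kE.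
have mS' : m = #|~: S'|.
  by move: mE (cardsC S) (cardsC S'); rewrite -kS' kE => <- <-; rewrite addnS addSn => -[/addnI].
set next := ohead _.
have rateE j : j \in S' ->
    AG0_rate (discount P) (startup P) r j = switching_ratio P j S'.
  by move=> jS'; apply: AG0_rateE => //=; rewrite jS'.
(* The truncated subtraction is exact: [out] lists distinct states of [S], and [k] is [#|S|.+1]. *)
have sz : (k - size out + size out = #|S'|)%N.
  rewrite subnK // kE leqW // -(size_map fst) -/(unzip1 out).
  by rewrite -(card_uniqP uout); apply/subset_leq_card/subsetP.
have sout' : {subset unzip1 out <= S'}.
  by move=> j /sout jS; rewrite !inE jS orbT.
have [u' s' new old] := AG0_whileP (AG0_rate (discount P) (startup P) r) next
  (tie0P k) uout sout' sz.
apply: IH => //=; first by rewrite -kS'.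
(* Rates outside [S'] are at most the index of [i], so calibration descends to the next index. *)
- move=> j /argmaxP[]; rewrite inE => jNS' jmax.
  apply: (calibrated_le calS') => [|l lNS']; first by case: calS' => _; exact.
  by apply: jmax; rewrite inE.
- move=> j v /new[/okout //|[jS' jN vE lt_v]]; rewrite vE rateE //.
  rewrite rateE // in vE; apply: switching_index_calibrated => //.
  apply: (calibrated_le calS').
    apply: switching_ratio_add => // jS.
    by have [x [<-]] := restout j jS jN.
  (* Without a next index, [S'] contains all states and no [l] is left to check. *)
  move=> l lNS'; case nextE: next => [x|].
    rewrite -vE; apply: ltW; apply: le_lt_trans (lt_v x nextE).
    exact: (AG1_loop_next mS' nextE).
  by move: lNS'; rewrite (AG1_loop_next_None mS' nextE) inE.
- by move=> j jS' jN; have [x nextE le_x] := old j jS' jN; exists x => //; rewrite -rateE.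
Qed.

End Loop.

Theorem theorem5p1 (R : realType) (N : finType) (P : project R N)
    (tie1 : nat -> {set N} -> N) (tie0 : nat -> nat -> {set N} -> N)
    (tie1P : forall k1 : nat, tie_rule (tie1 k1))
    (tie0P : forall k1 k0 : nat, tie_rule (tie0 k1 k0)) :
  let out := AG0 (discount P) (startup P) tie0 (AG1 P tie1) in
  perm_eq (unzip1 out) (enum N) /\
  (forall (i : N) (v : R), (i, v) \in out -> v = switching_index P i).
Proof.
apply: AG0_loopP => //; first by rewrite setC0 cardsT.
- by rewrite cards0.
(* All net values of the empty set are 0, so it is calibrated at the first index. *)
- move=> i /argmaxP[_ imax]; split=> [j|j jN]; first by rewrite net_out ?inE.
  by apply: imax; rewrite inE jN.
- by move=> j; rewrite inE.
Qed.
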